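(* Let $p$ be the mesh pattern $(12,R)$ with $R=\{(0,1),(0,2),(1,1),(1,2),(2,0),(2,2)\}$, let $E(t,u)=\sum_{n\ge0}t^n\sum_{\sigma\in K_n}u^{p(\sigma)}$, and let $P(t)=\sum_{n\ge0}|K_n(p)|t^n$. Then $$P(t)=\left(1+t-\frac{tA(t)}{1+t}\right)A(t),\qquad E(t,u)=\left(1+t-ut-\frac{t(1-u)A(t)}{1+t}\right)A(t).$$ The initial terms of $E(t,u)$ are $1+t+2t^4+(12+2u)t^5+(76+14u)t^6+(556+90u)t^7+(4596+646u)t^8+\cdots$.
   Context: A permutation $\sigma=\sigma_1\cdots\sigma_n$ of $\{1,\dots,n\}$ is a king permutation if $|\sigma_{i+1}-\sigma_i|>1$ for all $1\le i\le n-1$. $K_n$ is the set of king permutations of length $n$ ($K_0$ = the empty permutation, $K_1=\{1\}$) and $A(t)=\sum_{n\ge0}|K_n|t^n$ (known to equal $\sum_{n\ge0}n!\,t^n(1-t)^n/(1+t)^n$). For a mesh pattern $p=(12,R)$ with $R\subseteq\{0,1,2\}^2$, an occurrence of $p$ in $\sigma\in S_n$ is a pair of positions $i_1<i_2$ with $\sigma_{i_1}<\sigma_{i_2}$ such that for every $(x,y)\in R$ there is no position $m$ with $i_x<m<i_{x+1}$ and $v_y<\sigma_m<v_{y+1}$, where $i_0=0$, $i_3=n+1$, $v_0=0$, $v_1=\sigma_{i_1}$, $v_2=\sigma_{i_2}$, $v_3=n+1$ (first coordinate of a box indexes positions, second values). $p(\sigma)$ is the number of occurrences of $p$ in $\sigma$;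 $K_n(p)$ is the set of king $n$-permutations with $p(\sigma)=0$. *)

(* Defs.v *)
From HB Require Import structures.
From mathcomp Require Import all_boot all_order all_fingroup all_algebra.

Set Implicit Arguments.
Unset Strict Implicit.
Unset Printing Implicit Defensive.

Import GRing.Theory.
Local Open Scope ring_scope.

(* The formal power series sum_n (f n) t^n over R, as its coefficient sequence;
   equality of series is equality of all coefficients, f =1 g. *)
Definition fps (R : Type) : Type := nat -> R.

Declare Scope fps_scope.
Delimit Scope fps_scope with fps.
Bind Scope fps_scope with fps.

Section FormalPowerSeries.
Variable R : comUnitRingType.
Implicit Types f g : fps R.

Definition fpsC (c : R) : fps R := fun n => if n == 0%N then c else 0.
Definition fpsX : fps R := fun n => if n == 1%N then 1 else 0.
Definition fps_add f g : fps R := fun n => f n + g n.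
Definition fps_opp f : fps R := fun n => - f n.
Definition fps_mul f g : fps R := fun n => \sum_(k < n.+1) f k * g (n - k)%N.

(* The first n coefficients of 1/f, from
   f_0 h_n = [n = 0] - sum_(k < n) f_(n-k) h_k;
   meaningful when f 0 is a unit, see fps_mulV. *)
Fixpoint fps_inv_coefs f (n : nat) : seq R :=
  if n is m.+1 then
    let s := fps_inv_coefs f m in
    rcons s ((f 0%N)^-1 * ((m == 0%N)%:R - \sum_(k < m) f (m - k)%N * s`_k))
  else [::].
Definition fps_inv f : fps R := fun n => (fps_inv_coefs f n.+1)`_n.

Lemma size_fps_inv_coefs f n : size (fps_inv_coefs f n) = n.
Proof. by elim: n => //= n IHn; rewrite size_rcons IHn. Qed.

Lemma nth_fps_inv_coefs f n k :
  (k < n)%N -> (fps_inv_coefs f n)`_k = fps_inv f k.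
Proof.
elim: n => // n IHn; rewrite ltnS leq_eqVlt => /orP[/eqP -> // | ltkn].
by rewrite /= nth_rcons size_fps_inv_coefs ltkn IHn.
Qed.

Lemma fps_mulV f : f 0%N \is a GRing.unit -> fps_mul f (fps_inv f) =1 fpsC 1.
Proof.
move=> uf0 n; rewrite /fps_mul (reindex_inj rev_ord_inj) /= big_ord_recr /=.
rewrite !subSS subnn subn0 [X in _ + _ * X]/fps_inv /= nth_rcons.
rewrite size_fps_inv_coefs ltnn eqxx mulVKr //.
set S := \sum_(i < n) _; set T := \sum_(i < n) _.
suff -> : S = T by rewrite addrC subrK /fpsC; case: (n == 0%N).
apply: eq_bigr => k _; have ltkn := ltn_ord k.
by rewrite nth_fps_inv_coefs // subSS subKn // ltnW.
Qed.

End FormalPowerSeries.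

Notation "1" := (fpsC 1) : fps_scope.
Notation "f + g" := (fps_add f g) : fps_scope.
Notation "- f" := (fps_opp f) : fps_scope.
Notation "f - g" := (fps_add f (fps_opp g)) : fps_scope.
Notation "f * g" := (fps_mul f g) : fps_scope.
Notation "f / g" := (fps_mul f (fps_inv g)) : fps_scope.

(* A permutation s : 'S_n acts on {0, ..., n-1}; position i and value s i stand
   for the 1-based position i.+1 and value (s i).+1. *)
Definition king (n : nat) (s : 'S_n) : bool :=
  [forall i : 'I_n, forall j : 'I_n,
     (j == i.+1 :> nat) ==> (1 < `|(s j)%:Z - (s i)%:Z|)].

Definition kings (n : nat) : {set 'S_n} := [set s : 'S_n | king s].

(* The bounds b_0 = 0 < b_1 = a < b_2 = b < b_3 = n+1 of the mesh lines, used
   both for positions and for values (1-based). *)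
Definition mesh_line (n a b k : nat) : nat := nth 0%N [:: 0%N; a; b; n.+1] k.

(* Occurrence of the mesh pattern (12, Rset) at positions i, j; the first
   coordinate of a box indexes positions, the second one values. *)
Definition occurs12 (Rset : {set 'I_3 * 'I_3}) (n : nat) (s : 'S_n)
    (i j : 'I_n) : bool :=
  let pos := mesh_line n i.+1 j.+1 in
  let val := mesh_line n (s i).+1 (s j).+1 in
  [&& (i < j)%N, (s i < s j)%N &
   [forall x : 'I_3, forall y : 'I_3, ((x, y) \in Rset) ==>
      ~~ [exists m : 'I_n, (pos x < m.+1 < pos x.+1)%N
                        && (val y < (s m).+1 < val y.+1)%N]]].

Definition noccs12 (Rset : {set 'I_3 * 'I_3}) (n : nat) (s : 'S_n) : nat :=
  #|[set ij : 'I_n * 'I_n | occurs12 Rset s ij.1 ij.2]|.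

Definition kings_avoiding (Rset : {set 'I_3 * 'I_3}) (n : nat) : {set 'S_n} :=
  [set s in kings n | noccs12 Rset s == 0%N].

Definition shading : {set 'I_3 * 'I_3} :=
  [set b : 'I_3 * 'I_3 |
     (val b.1, val b.2) \in
       [:: (0, 1); (0, 2); (1, 1); (1, 2); (2, 0); (2, 2)]%N].

Definition king_gf (R : comUnitRingType) : fps R := fun n => #|kings n|%:R.

Definition avoid_gf (R : comUnitRingType) (Rset : {set 'I_3 * 'I_3}) : fps R :=
  fun n => #|kings_avoiding Rset n|%:R.

(* E(t,u) as a series in t over Z[u]; the polynomial variable 'X is u. *)
Definition occ_gf (Rset : {set 'I_3 * 'I_3}) : fps {poly int} :=
  fun n => \sum_(s in kings n) 'X^(noccs12 Rset s).

(* Main.v *)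
(** An occurrence of the pattern forces [s j] to be the maximum [n], the entries
    to its left to be a permutation of [1..k] with [k = j - 1 > 0], and those to
    its right to be the values between: [s = a n b] with [b] a shifted
    permutation. So there is at most one occurrence.  Let [D] count the king
    permutations of length [m] whose first entry is not [m], the empty one
    included.  Removing an initial maximum gives [A = (1 + t) D].  In [a n b],
    [n] must not be adjacent in value to its neighbours: for nonempty [b] this
    only restricts [b], and for empty [b] it restricts [a], which by reversal is
    again counted by [D]. Hence the occurrences are counted by
    [O = t A (D - 1)], and [P = A - O], [E = A - (1 - u) O]. *)
Require Import Defs.
From Stdlib Require Import Setoid Ring Ring_theory.
From mathcomp Require Import all_boot all_order all_fingroup all_algebra zify.

Set Implicit Arguments.
Unset Strict Implicit.
Unset Printing Implicit Defensive.

Import GRing.Theory.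
Local Open Scope ring_scope.

(** * The ring of formal power series *)

Section FpsRing.
Variable R : comUnitRingType.
Implicit Types f g h : fps R.

Definition fps_eq f g : Prop := f =1 g.

Lemma fps_eq_equiv : Equivalence fps_eq.
Proof. by split=> [f n | f g fg n | f g h fg gh n]; rewrite ?fg ?gh. Qed.

Lemma fps_eq_ext : ring_eq_ext (@fps_add R) (@fps_mul R) (@fps_opp R) fps_eq.
Proof.
split=> [f f' ff' g g' gg' n | f f' ff' g g' gg' n | f f' ff' n].
- by rewrite /fps_add ff' gg'.
- by apply: eq_bigr => k _; rewrite ff' gg'.
- by rewrite /fps_opp ff'.
Qed.

(** The coefficient of [t^n] involves only coefficients of index at most [n], so truncation loses
    nothing and the ring laws can be taken from polynomials. *)
Lemma fps_mul_poly f g n N :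
  (n < N)%N -> fps_mul f g n = (\poly_(i < N) f i * \poly_(i < N) g i)`_n.
Proof.
move=> ltnN; rewrite coefM; apply: eq_bigr => k _.
have lekn : (k <= n)%N by rewrite -ltnS.
by rewrite !coef_poly (leq_ltn_trans lekn ltnN) (leq_ltn_trans (leq_subr _ _) ltnN).
Qed.

Lemma fps_mulC f g : fps_eq (fps_mul f g) (fps_mul g f).
Proof. by move=> n; rewrite !(fps_mul_poly _ _ (ltnSn n)) mulrC. Qed.

Lemma fps_mulA f g h :
  fps_eq (fps_mul f (fps_mul g h)) (fps_mul (fps_mul f g) h).
Proof.
move=> n; pose T (e : fps R) := \poly_(i < n.+1) e i.
have TE (e : fps R) k : (k <= n)%N -> e k = (T e)`_k.
  by move=> lekn; rewrite coef_poly ltnS lekn.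
transitivity ((T f * (T g * T h))`_n).
  rewrite coefM; apply: eq_bigr => k _; rewrite -(TE f) -1?ltnS //.
  by rewrite (fps_mul_poly _ _ (N := n.+1)) // ltnS leq_subr.
rewrite mulrA coefM; apply: eq_bigr => k _; rewrite -(TE h) ?leq_subr //.
by rewrite (fps_mul_poly _ _ (N := n.+1)).
Qed.

Lemma fps_mul1 f : fps_eq (fps_mul (fpsC 1) f) f.
Proof.
move=> n; rewrite /fps_mul big_ord_recl /= subn0 mul1r big1 ?addr0 // => k _.
by rewrite /fpsC /= mul0r.
Qed.

Lemma fps_mulDl f g h :
  fps_eq (fps_mul (fps_add f g) h) (fps_add (fps_mul f h) (fps_mul g h)).
Proof.
by move=> n; rewrite /fps_add -big_split; apply: eq_bigr => k _; apply: mulrDl.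
Qed.

Lemma fps_ring_theory :
  ring_theory (fpsC 0) (fpsC 1) (@fps_add R) (@fps_mul R)
    (fun f g => fps_add f (fps_opp g)) (@fps_opp R) fps_eq.
Proof.
split; [| | | exact: fps_mul1 | exact: fps_mulC | exact: fps_mulA
  | exact: fps_mulDl | by [] |] => [f n | f g n | f g h n | f n];
  rewrite /fps_add /fps_opp /fpsC; first by case: (n == _); rewrite add0r.
- exact: addrC.
- exact: addrA.
- by rewrite subrr; case: (n == _).
Qed.

Lemma fps_mulX f n :
  fps_mul (fpsX R) f n = if n is m.+1 then f m else 0.
Proof.
rewrite /fps_mul big_ord_recl /fpsX mul0r add0r.
case: n => [|n]; first by rewrite big_ord0.
rewrite big_ord_recl /= mul1r subSS subn0 big1 ?addr0 // => k _.
by rewrite mul0r.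
Qed.

Lemma fps_mul_const f g n :
  (forall k, f k.+1 = 0) -> fps_mul f g n = f 0%N * g n.
Proof.
move=> f0; rewrite /fps_mul big_ord_recl /= subn0 big1 ?addr0 // => k _.
by rewrite f0 mul0r.
Qed.

Add Parametric Relation : (fps R) fps_eq
  reflexivity proved by (@Equivalence_Reflexive _ _ fps_eq_equiv)
  symmetry proved by (@Equivalence_Symmetric _ _ fps_eq_equiv)
  transitivity proved by (@Equivalence_Transitive _ _ fps_eq_equiv)
  as fps_eq_rel.
Add Parametric Morphism : (@fps_add R) with signature
  fps_eq ==> fps_eq ==> fps_eq as fps_add_mor.
Proof. exact: (Radd_ext fps_eq_ext). Qed.
Add Parametric Morphism : (@fps_mul R) with signature
  fps_eq ==> fps_eq ==> fps_eq as fps_mul_mor.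
Proof. exact: (Rmul_ext fps_eq_ext). Qed.
Add Parametric Morphism : (@fps_opp R) with signature
  fps_eq ==> fps_eq as fps_opp_mor.
Proof. exact: (Ropp_ext fps_eq_ext). Qed.

Add Ring fps_ring : fps_ring_theory (setoid fps_eq_equiv fps_eq_ext).

(** As [1 + t] has constant term 1, it is invertible and [A / (1 + t)] equals [D]; after this
    substitution a ring identity remains. Here [w] plays the part of [u]. *)
Lemma occurrence_series_identity (A D E O w : fps R) (t := fpsX R) :
    fps_eq A ((1 + t) * D)%fps -> fps_eq O (t * (A * (D - 1)))%fps ->
    fps_eq E (A - (1 - w) * O)%fps ->
  fps_eq E ((1 + t - w * t - (t * (1 - w) * A) / (1 + t)) * A)%fps.
Proof.
move=> AE OE EE; set V := fps_inv (1 + t)%fps.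
have V1 : fps_eq ((1 + t) * V)%fps 1%fps.
  by apply: fps_mulV; rewrite /fps_add /fpsC /t /fpsX /= addr0 unitr1.
have DE : fps_eq (A * V)%fps D.
  transitivity (((1 + t) * V) * D)%fps; first by rewrite AE; ring.
  by rewrite V1; ring.
transitivity ((1 + t - w * t - (t * (1 - w)) * (A * V)) * A)%fps; last by ring.
by rewrite EE OE DE; ring.
Qed.

Lemma avoidance_series_identity (A D P O : fps R) (t := fpsX R) :
    fps_eq A ((1 + t) * D)%fps -> fps_eq O (t * (A * (D - 1)))%fps ->
    fps_eq P (A - O)%fps ->
  fps_eq P ((1 + t - (t * A) / (1 + t)) * A)%fps.
Proof.
move=> AE OE PE.
(* Avoidance is the specialization [w = 0]. *)
have PE0 : fps_eq P (A - (1 - fpsC 0) * O)%fps by rewrite PE; ring.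
have := occurrence_series_identity AE OE PE0.
by move/(Equivalence_Transitive (R := fps_eq)); apply; rewrite /t; ring.
Qed.

End FpsRing.

Local Close Scope ring_scope.

(** * King permutations as words *)

Definition nonadj : rel nat := fun a b => (a.+1 < b) || (b.+1 < a).

Lemma nonadj_sym : symmetric nonadj.
Proof. by move=> a b; rewrite /nonadj orbC. Qed.

Lemma path_nonadj_shift k a w :
  path nonadj (k + a) (map (addn k) w) = path nonadj a w.
Proof. by rewrite path_map; apply: eq_path => b c; rewrite /nonadj /=; lia. Qed.

Definition words n := permutations (iota 0 n).

Definition nkings n := count (sorted nonadj) (words n).

(* King words of length [n] that stay king after prepending [n]. *)
Definition nkings_below n := count (path nonadj n) (words n).

Lemma mem_words n w : (w \in words n) = perm_eq w (iota 0 n).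
Proof. exact: mem_permutations. Qed.

Lemma size_word n w : w \in words n -> size w = n.
Proof. by rewrite mem_words => /perm_size; rewrite size_iota. Qed.

Lemma ltn_word n w x : w \in words n -> x \in w -> x < n.
Proof. by rewrite mem_words => /perm_mem ->; rewrite mem_iota. Qed.

Lemma uniq_word n w : w \in words n -> uniq w.
Proof. by rewrite mem_words => /perm_uniq ->; apply: iota_uniq. Qed.

Lemma perm_rev_words n : perm_eq (map rev (words n)) (words n).
Proof.
have uw := permutations_uniq (iota 0 n).
apply: uniq_perm; rewrite ?map_inj_uniq //; first exact: can_inj revK.
by move=> w; rewrite -{1}(revK w) mem_map ?mem_words ?perm_rev //; apply: can_inj revK.
Qed.

(* [w = v n-1 w'] with [v] a permutation of the [k] least values. *)
Definition splits_at n k (w : seq nat) :=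
  (nth 0 w k == n.-1) && all (gtn k) (take k w).

Definition glue k m (v w : seq nat) := v ++ (k + m) :: map (addn k) w.

Lemma glue_word k m v w :
  v \in words k -> w \in words m -> glue k m v w \in words (k + m).+1.
Proof.
rewrite !mem_words => vP wP; rewrite -addnS iotaD; apply: perm_cat => //.
rewrite -addn1 iotaD add0n /= perm_sym cats1 perm_rcons perm_cons perm_sym.
by rewrite -{2}(addn0 k) iotaDl; apply: perm_map.
Qed.

Lemma glue_inj k m v v' w w' :
  size v = k -> size v' = k -> glue k m v w = glue k m v' w' -> v = v' /\ w = w'.
Proof.
move=> sv sv' /eqP; rewrite eqseq_cat ?sv ?sv' // => /andP[/eqP -> /eqP[]].
by move/(inj_map (@addnI _)).
Qed.

(** Cutting a word at its maximum, in position [k], and lowering the right part by [k] undoes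
    [glue]. *)
Lemma splitting_words k m :
  perm_eq [seq w <- words (k + m).+1 | splits_at (k + m).+1 k w]
          [seq glue k m v w | v <- words k, w <- words m].
Proof.
apply: uniq_perm.
- exact/filter_uniq/permutations_uniq.
- apply: allpairs_uniq; try exact: permutations_uniq.
  move=> _ _ /allpairsP[[v w] /= [vP _ ->]] /allpairsP[[v' w'] /= [v'P _ ->]] /=.
  by case/(glue_inj (size_word vP) (size_word v'P)) => -> ->.
move=> u; rewrite mem_filter; apply/andP/allpairsP; last first.
  case=> [[v w] /= [vP wP ->]]; split; last exact: glue_word.
  rewrite /splits_at /glue nth_cat (size_word vP) ltnn subnn eqxx /=.
  rewrite take_size_cat ?(size_word vP) //.
  by apply/allP => x xv; apply: ltn_word xv.
case=> /andP[/eqP nth_u take_u] uP.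
have su := size_word uP; have uu := uniq_word uP.
have ltk : k < size u by rewrite su ltnS leq_addr.
have uE : u = take k u ++ (k + m) :: drop k.+1 u.
  by rewrite -{1}(cat_take_drop k u) (drop_nth 0) // nth_u.
have tP : take k u \in words k.
  rewrite mem_words; apply: uniq_perm; rewrite ?take_uniq ?iota_uniq //.
  (* The prefix has [k] distinct entries below [k], so it exhausts these values. *)
  apply: (fun sub le => (uniq_min_size (take_uniq k uu) sub le).2) => [x xt |].
    by rewrite mem_iota; apply: (allP take_u).
  by rewrite size_takel ?size_iota // ltnW.
have dP : perm_eq (drop k.+1 u) (map (addn k) (iota 0 m)).
  move: tP; rewrite mem_words => tP.
  (* Both lists are permutations of the same interval, and their common prefix cancels. *)
  have : perm_eq (take k u ++ k + m :: drop k.+1 u)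
                 (take k u ++ k + m :: map (addn k) (iota 0 m)).
    rewrite -uE (perm_trans (y := iota 0 (k + m).+1)) //; first by rewrite -mem_words.
    rewrite perm_sym -mem_words; apply: (@glue_word k m); by rewrite mem_words.
  by rewrite perm_cat2l perm_cons.
exists (take k u, map (subn^~ k) (drop k.+1 u)); split=> //=.
  rewrite mem_words (perm_trans (perm_map _ dP)) // -map_comp map_id_in //.
  by move=> x _ /=; rewrite addKn.
rewrite /glue -map_comp map_id_in // => x; rewrite (perm_mem dP).
by case/mapP=> y _ -> /=; rewrite addKn.
Qed.

(** Nonadjacency is invariant under the shift by [k], so the right part only sees a maximum [m] in
    front of it. The guard [0 < k] discards the default value of [last] on an empty [v]. *)
Lemma sorted_glue k m v w : v \in words k ->
  sorted nonadj (glue k m v w) =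
  [&& sorted nonadj v, (0 < k) ==> nonadj (last 0 v) (k + m) & path nonadj m w].
Proof.
move=> vP; rewrite -(path_nonadj_shift k) /glue -(size_word vP).
by case: v {vP} => //= a v; rewrite cat_path /=.
Qed.

Definition nsplits k m :=
  \sum_(w <- words (k + m).+1 | sorted nonadj w) splits_at (k + m).+1 k w.

Lemma nsplitsE k m :
  nsplits k m = \sum_(v <- words k) \sum_(w <- words m) sorted nonadj (glue k m v w).
Proof.
rewrite -(big_allpairs_dep (F := fun u => nat_of_bool (sorted nonadj u))).
rewrite -(perm_big _ (splitting_words k m)) big_filter /nsplits.
rewrite [LHS]big_mkcond [RHS]big_mkcond; apply: eq_bigr => w _.
by case: sorted; case: splits_at.
Qed.

(** The last entry of [v] is below [k], hence at least 2 below the maximum [k + m]; only the right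
    part is restricted. *)
Lemma nsplits_pos k m : 0 < m -> nsplits k m = nkings k * nkings_below m.
Proof.
move=> m0; rewrite nsplitsE /nkings -sum1_count [X in X * _]big_mkcond big_distrl /=.
apply: eq_big_seq => v vP; rewrite /nkings_below -sum1_count.
rewrite big_distrr /= [RHS]big_mkcond /=.
apply: eq_bigr => w _; rewrite sorted_glue //.
case: (posnP k) => [k0 | k0] /=; first by case: sorted; case: path.
suff -> : nonadj (last 0 v) (k + m) by case: sorted; case: path.
have : last 0 v < k.
  apply: (ltn_word vP); move: (size_word vP) k0.
  by case: v {vP} => [<- //| a v _ _]; apply: mem_last.
rewrite /nonadj; lia.
Qed.

(** The maximum now ends the word; reversal moves it to the front. *)
Lemma nsplits0 k : nsplits k 0 = nkings_below k.
Proof.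
rewrite nsplitsE /nkings_below -sum1_count.
rewrite -[RHS](perm_big _ (perm_rev_words k)) big_map.
rewrite [RHS]big_mkcond /=; apply: eq_big_seq => v vP.
rewrite big_seq1 /glue addn0 /= cats1 -(revK (rcons v k)) rev_rcons rev_sorted /=.
have -> : path (fun a => nonadj^~ a) k (rev v) = path nonadj k (rev v).
  by apply: eq_path => a b; apply: nonadj_sym.
by case: path.
Qed.

(** This is [A = (1 + t) D] read off coefficientwise: a king word either starts below its maximum
    [n], or starts with [n] and so splits at position 0. *)
Lemma nkingsS n : nkings n.+1 = nkings_below n.+1 + nkings_below n.
Proof.
have <- : nsplits 0 n = nkings_below n.
  rewrite nsplitsE big_seq1 /nkings_below -sum1_count [RHS]big_mkcond.
  by apply: eq_bigr => w _; rewrite sorted_glue //=; case: path.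
rewrite /nkings /nkings_below /nsplits -!sum1_count [LHS]big_mkcond.
rewrite [X in X + _]big_mkcond [X in _ + X]big_mkcond -big_split /=.
apply: eq_big_seq => w wP; have := size_word wP; have := @ltn_word _ _^~ wP.
rewrite /splits_at take0 /= andbT.
case: w {wP} => // a w /(_ a); rewrite mem_head => /(_ isT) /= an _.
have -> : nonadj n.+1 a = (a != n) by rewrite /nonadj; lia.
by case: path; case: eqP.
Qed.

(** The boundary term [nsplits n 0] on the left supplies the term [k = 0] on the right, since
    [nkings 0] is 1; the other terms agree one by one. *)
Lemma sum_nsplits n :
  \sum_(1 <= k < n.+1) nsplits k (n - k) =
  \sum_(k < n) nkings k * nkings_below (n - k).
Proof.
case: n => [|n]; first by rewrite big_geq // big_ord0.
rewrite big_nat_recr //= subnn nsplits0 addnC big_ord_recl /= subn0.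
rewrite mul1n; congr (_ + _); rewrite big_add1 /= big_mkord.
apply: eq_bigr => k _; rewrite nsplits_pos /bump //=; have := ltn_ord k; lia.
Qed.

(** * Occurrences of the pattern *)

Section OneLine.
Variable n : nat.
Implicit Types s : 'S_n.

Definition oneline s : seq nat := [seq val (s i) | i <- enum 'I_n].

Lemma nth_oneline s (i : 'I_n) : nth 0 (oneline s) i = s i.
Proof. by rewrite (nth_map i) ?nth_ord_enum // size_enum_ord. Qed.

Lemma size_oneline s : size (oneline s) = n.
Proof. by rewrite size_map size_enum_ord. Qed.

Lemma oneline_inj : injective oneline.
Proof.
move=> s s' eq_ss'; apply/permP => i; apply: val_inj.
by rewrite /= -!nth_oneline eq_ss'.
Qed.

Lemma oneline_word s : oneline s \in words n.
Proof.
have us : uniq (oneline s).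
  rewrite map_inj_uniq ?enum_uniq // => i j /val_inj; exact: perm_inj.
rewrite mem_words; apply: uniq_perm; rewrite ?iota_uniq //.
apply: (fun sub le => (uniq_min_size us sub le).2) => [x |].
  by case/mapP=> i _ ->; rewrite mem_iota /=.
by rewrite size_oneline size_iota.
Qed.

Lemma perm_oneline : perm_eq (map oneline (index_enum 'S_n)) (words n).
Proof.
have uo : uniq (map oneline (index_enum 'S_n)).
  by rewrite (map_inj_uniq oneline_inj) index_enum_uniq.
apply: uniq_perm; rewrite ?permutations_uniq //.
apply: (fun sub le => (uniq_min_size uo sub le).2) => [w |].
  by case/mapP=> s _ ->; apply: oneline_word.
rewrite size_permutations ?iota_uniq // size_iota size_map.
by rewrite -card_Sn -sum1_card -sum1_size.
Qed.

Lemma king_oneline s : king s = sorted nonadj (oneline s).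
Proof.
apply/forallP/(sortedP 0) => [ks i | so i].
  rewrite size_oneline => lti; have /forallP/(_ (Ordinal lti)) := ks (Ordinal (ltnW lti)).
  rewrite eqxx /= -!nth_oneline /= /nonadj; lia.
apply/forallP => j; apply/implyP => /eqP ji.
have := so i; rewrite size_oneline -ji ltn_ord => /(_ isT).
rewrite !nth_oneline /nonadj; lia.
Qed.

Lemma sum_kings (R : nmodType) (F : seq nat -> R) :
  (\sum_(s in kings n) F (oneline s) = \sum_(w <- words n | sorted nonadj w) F w)%R.
Proof.
rewrite -(perm_big _ perm_oneline) big_map; apply: eq_bigl => s.
by rewrite inE king_oneline.
Qed.

Lemma splits_at_oneline s (j : 'I_n) :
  splits_at n j (oneline s) =
  (s j == n.-1 :> nat) && [forall m : 'I_n, (m < j) ==> (s m < j)].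
Proof.
rewrite /splits_at nth_oneline; congr (_ && _).
apply/(all_nthP 0)/forallP => [allj m | allj m].
  apply/implyP => ltmj; have := allj m; rewrite size_takel; last first.
    by rewrite size_oneline ltnW.
  by move/(_ ltmj); rewrite nth_take // nth_oneline.
rewrite size_takel; last by rewrite size_oneline ltnW.
move=> ltmj; have ltmn := ltn_trans ltmj (ltn_ord j).
rewrite nth_take // -[m]/(val (Ordinal ltmn)) nth_oneline /=.
by have /implyP := allj (Ordinal ltmn); apply.
Qed.

Lemma perm_val_eq s (i j : 'I_n) : (s i == s j :> nat) = (i == j :> nat).
Proof. exact: (inj_eq (@perm_inj _ s)). Qed.

(** The four boxes in columns 0 and 1 say that nothing before [j] exceeds [s i]; the two in column 2
    confine the entries after [j] between [s i] and [s j]. *)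
Lemma occurs12_shadingP s (i j : 'I_n) :
  reflect [/\ i < j, s i < s j,
    forall m : 'I_n, m < j -> s m <= s i &
    forall m : 'I_n, j < m -> s i < s m < s j]
  (occurs12 shading s i j).
Proof.
apply: (iffP and3P) => [[ltij ltsij /forallP noccs] | [ltij ltsij left right]].
  have box (x y : 'I_3) (m : 'I_n) :
     (val x, val y) \in [:: (0, 1); (0, 2); (1, 1); (1, 2); (2, 0); (2, 2)] ->
     mesh_line n i.+1 j.+1 x < m.+1 < mesh_line n i.+1 j.+1 x.+1 ->
     mesh_line n (s i).+1 (s j).+1 y < (s m).+1 < mesh_line n (s i).+1 (s j).+1 y.+1 ->
     False.
    move=> xy px py; have /forallP/(_ y)/implyP := noccs x.
    by rewrite inE => /(_ xy)/existsP; case; exists m; rewrite px py.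
  have inj := perm_val_eq s.
  split=> // m ltm.
    rewrite leqNgt; apply/negP => gtm.
    have im := inj m i; have jm := inj m j; have ltsm := ltn_ord (s m).
    have := @box (@Ordinal 3 0 isT) (@Ordinal 3 1 isT) m isT.
    have := @box (@Ordinal 3 0 isT) (@Ordinal 3 2 isT) m isT.
    have := @box (@Ordinal 3 1 isT) (@Ordinal 3 1 isT) m isT.
    have := @box (@Ordinal 3 1 isT) (@Ordinal 3 2 isT) m isT.
    rewrite /mesh_line /=; lia.
  have im := inj m i; have jm := inj m j; have ltsm := ltn_ord (s m).
  have := @box (@Ordinal 3 2 isT) (@Ordinal 3 0 isT) m isT.
  have := @box (@Ordinal 3 2 isT) (@Ordinal 3 2 isT) m isT.
  have := ltn_ord m; rewrite /mesh_line /=; lia.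
split=> //; apply/forallP => -[x ltx]; apply/forallP => -[y lty].
apply/implyP; rewrite inE /= => xy; apply/negP => /existsP[m].
have := left m; have := right m; rewrite /mesh_line.
by move: x y {ltx lty} xy => [|[|[|x]]] [|[|[|y]]] //= _; lia.
Qed.

Lemma card_ltn_ord (j : nat) : j <= n -> #|[set m : 'I_n | m < j]| = j.
Proof.
move=> lejn; rewrite -sum1_card.
under eq_bigl do rewrite inE.
by rewrite -(big_ord_widen n (fun=> 1)) // sum1_card card_ord.
Qed.

Lemma card_perm_ltn_ord s (j : nat) : j <= n -> #|[set m : 'I_n | s m < j]| = j.
Proof.
move=> lejn; rewrite -[RHS]card_ltn_ord // -[RHS](card_preimset _ (@perm_inj _ s)).
by apply: eq_card => m; rewrite !inE.
Qed.

(** An occurrence is determined by [j]: the [j] entries to its left are the [j] least values, and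
    [i] is the position of the greatest of them. *)
Lemma occurs12_split s (i j : 'I_n) :
  occurs12 shading s i j =
  [&& 0 < j, splits_at n j (oneline s) & s i == j.-1 :> nat].
Proof.
have inj := perm_val_eq s.
rewrite splits_at_oneline; apply/occurs12_shadingP/and3P.
  case=> ltij ltsij left right.
  (* The positions before [j] are exactly those with value at most [s i]; count both sets. *)
  have sij : (s i).+1 = j.
    rewrite -(card_perm_ltn_ord s (ltn_ord (s i))).
    rewrite -[RHS](card_ltn_ord (ltnW (ltn_ord j))).
    apply: eq_card => m; rewrite !inE ltnS.
    case: (ltngtP m j) => [/left // | /right | /val_inj ->]; lia.
  split; first by lia.
    apply/andP; split; last first.
      by apply/forallP => m; apply/implyP => /left; rewrite -sij ltnS.
    have ltn1 : n.-1 < n by have := ltn_ord j; lia.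
    (* The position of the value [n - 1] can lie neither before nor after [j]. *)
    pose m := (s^-1)%g (Ordinal ltn1).
    have sm : s m = n.-1 :> nat by rewrite permKV.
    have := ltn_ord (s j).
    case: (ltngtP m j) => [/left | /right | /val_inj <-]; lia.
  by rewrite -sij.
case=> j0 /andP[/eqP sj /forallP left] /eqP si.
(* An inclusion between two sets of cardinality [j] is an equality. *)
have belowE : [set m : 'I_n | m < j] = [set m : 'I_n | s m < j].
  apply/eqP; rewrite eqEcard card_perm_ltn_ord ?card_ltn_ord ?leqnn ?andbT;
    try exact: ltnW.
  by apply/subsetP => m; rewrite !inE; apply/implyP.
have belowP (m : 'I_n) : (m < j) = (s m < j) by have /setP/(_ m) := belowE; rewrite !inE.
have ltij : i < j by rewrite belowP; lia.
split=> // [|m | m ltjm].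
- have := inj i j; have := ltn_ord (s i); lia.
- by rewrite belowP; lia.
- have := belowP m; have := inj m j; have := ltn_ord (s m); lia.
Qed.

(** Each split position [j > 0] carries exactly one [i], the preimage of [j - 1]. *)
Lemma noccs12_splits s :
  noccs12 shading s = \sum_(1 <= k < n) splits_at n k (oneline s).
Proof.
rewrite /noccs12 -sum1_card big_mkcond /=.
pose occ i j := nat_of_bool (occurs12 shading s i j).
rewrite (eq_bigr (fun ij : 'I_n * 'I_n => occ ij.1 ij.2)); last first.
  by case=> i j _; rewrite inE /occ /=; case: occurs12.
rewrite -(pair_bigA _ occ) /= exchange_big /= /occ.
rewrite [RHS](big_nat_widenl _ 0) // big_mkord [RHS]big_mkcond /=.
apply: eq_bigr => j _; case: ifP => j0; last first.
  by rewrite big1 // => i _; rewrite occurs12_split j0.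
under eq_bigr do rewrite occurs12_split j0 /=.
case: splits_at; last by rewrite big1.
have ltj : j.-1 < n by have := ltn_ord j; lia.
rewrite (bigD1 ((s^-1)%g (Ordinal ltj))) //= permKV eqxx big1 // => i neq_i.
case: eqP => // /(@val_inj _ _ _ _ (Ordinal ltj)) si.
by rewrite -si permK eqxx in neq_i.
Qed.

(** A split position must be the position of the value [n - 1], which is unique. *)
Lemma noccs12_le1 s : noccs12 shading s <= 1.
Proof.
rewrite noccs12_splits.
case: (posnP n) => [n0 | n0]; first by rewrite big_geq // n0.
have ltn1 : n.-1 < n by lia.
rewrite (big_nat_widenl _ 0) // big_mkord big_mkcond /=.
rewrite (bigD1 ((s^-1)%g (Ordinal ltn1))) //= big1 ?addn0 => [|j neq_j].
  by case: ifP => // _; case: splits_at.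
rewrite splits_at_oneline; case: eqP => [/(@val_inj _ _ _ _ (Ordinal ltn1)) sj|].
  by rewrite -sj permK eqxx in neq_j.
by case: ifP.
Qed.

End OneLine.

(** * Totals over king permutations and their numerical values *)

Lemma card_kings n : #|kings n| = nkings n.
Proof.
rewrite -sum1_card (sum_kings n (fun=> 1)).
by rewrite /nkings -sum1_count.
Qed.

Lemma total_noccs12 n :
  \sum_(s in kings n.+1) noccs12 shading s =
  \sum_(k < n) nkings k * nkings_below (n - k).
Proof.
rewrite -sum_nsplits.
under eq_bigr do rewrite noccs12_splits.
rewrite exchange_big /=; apply: eq_big_nat => k /andP[k0 lekn].
rewrite (sum_kings _ (fun w => nat_of_bool (splits_at n.+1 k w))).
by rewrite /nsplits subnKC.
Qed.

(* Backtracking count of the orderings of [s] that continue a king word ending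
   in [a]. *)
Fixpoint npaths (fuel a : nat) (s : seq nat) : nat :=
  if fuel is m.+1 then
    sumn [seq npaths m b (rem b s) | b <- s & nonadj a b]
  else 1.

(** Orderings are grouped by their first entry [b]; what follows is an ordering of [rem b s] that
    continues from [b]. *)
Lemma npathsE fuel a s :
  uniq s -> size s = fuel -> npaths fuel a s = count (path nonadj a) (permutations s).
Proof.
elim: fuel a s => [|m IH] a s us ss; first by case: s us ss.
have /permutationsE/seq.permP -> : 0 < size s by rewrite ss.
rewrite undup_id // count_flatten -map_comp /= !sumnE !big_map big_filter big_mkcond /=.
apply: eq_big_seq => b bs; rewrite count_map.
case: ifP => nab; last first.
  by rewrite (eq_count (a2 := pred0)) ?count_pred0 // => w /=; rewrite nab.
rewrite IH ?rem_uniq ?size_rem ?ss //.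
by apply: eq_count => w /=; rewrite nab.
Qed.

Lemma nkings_belowE n : nkings_below n = npaths n n (iota 0 n).
Proof. by rewrite npathsE ?iota_uniq ?size_iota. Qed.

Definition below_values := [:: 1; 0; 0; 0; 2; 12; 78; 568; 4674].

(** The pruned search makes length 8 computable without listing all [8!] orderings. *)
Lemma nkings_below_values :
  map nkings_below (iota 0 9) = below_values.
Proof.
by rewrite (eq_map nkings_belowE); vm_compute.
Qed.

Local Open Scope ring_scope.

(** * Generating functions and initial terms *)

Definition total_occs n : nat := (\sum_(s in kings n) noccs12 shading s)%N.

Lemma total_occs0 : total_occs 0 = 0%N.
Proof. by rewrite /total_occs big1 // => s _; rewrite noccs12_splits big_geq. Qed.

Lemma card_avoiding n :
  #|kings_avoiding shading n| = (\sum_(s in kings n) (noccs12 shading s == 0))%N.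
Proof.
rewrite -sum1_card [RHS]big_mkcond [LHS]big_mkcond /=; apply: eq_bigr => s _.
by rewrite inE; case: (s \in kings n); case: eqP.
Qed.

Lemma card_avoidingD n :
  (#|kings_avoiding shading n| + total_occs n)%N = nkings n.
Proof.
rewrite card_avoiding -card_kings -sum1_card -big_split /=.
by apply: eq_bigr => s _; have := noccs12_le1 s; lia.
Qed.

(** With at most one occurrence, the weight [u^p] is 1 when [p = 0] and [u] when [p = 1], hence
    linear in [p]. *)
Lemma occ_gfE n :
  occ_gf shading n = #|kings_avoiding shading n|%:R + (total_occs n)%:R * 'X.
Proof.
rewrite card_avoiding !natr_sum mulr_suml -big_split /=.
apply: eq_bigr => s _; have := noccs12_le1 s.
case: (noccs12 shading s) => [|[|//]] _.
  by rewrite expr0 mul0r addr0.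
by rewrite mul1r add0r.
Qed.

Section KingSeries.
Variable R : comUnitRingType.

Definition below_gf : fps R := fun n => (nkings_below n)%:R.
Definition total_gf : fps R := fun n => (total_occs n)%:R.

Lemma king_gfE : fps_eq (king_gf R) ((1 + fpsX R) * below_gf)%fps.
Proof.
move=> n; rewrite (fps_mulDl _ _ _ n) /fps_add (fps_mul1 _ n) fps_mulX.
rewrite /king_gf card_kings /below_gf.
by case: n => [|n]; rewrite ?addr0 // nkingsS natrD.
Qed.

Lemma total_gfE :
  fps_eq total_gf (fpsX R * (king_gf R * (below_gf - 1)))%fps.
Proof.
move=> [|n]; rewrite fps_mulX /total_gf; first by rewrite total_occs0.
(* The last term of the convolution vanishes because [D - 1] has constant term 0; at positive
   indices the subtracted 1 has no effect. *)
rewrite /total_occs total_noccs12 /fps_mul big_ord_recr /= subnn.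
rewrite /fps_add /fps_opp [fpsC 1 0%N]/= subrr mulr0 addr0 natr_sum.
apply: eq_bigr => k _; rewrite /king_gf card_kings natrM /fpsC.
by rewrite subn_eq0 leqNgt ltn_ord oppr0 addr0.
Qed.

Lemma avoid_gfE :
  fps_eq (avoid_gf R shading) (king_gf R - total_gf)%fps.
Proof.
move=> n; rewrite /fps_add /fps_opp /king_gf card_kings -card_avoidingD natrD.
by rewrite addrK.
Qed.

End KingSeries.

Lemma occ_gf_series (A := king_gf {poly int}) :
  fps_eq (occ_gf shading) (A - (1 - fpsC 'X) * total_gf {poly int})%fps.
Proof.
move=> n; rewrite occ_gfE /fps_add /fps_opp fps_mul_const /fpsC /=; last first.
  by move=> k; rewrite oppr0 addr0.
rewrite /A /king_gf card_kings -card_avoidingD natrD /total_gf mulrBl mul1r.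
by rewrite opprB addrA [X in X - _]addrAC addrK mulrC.
Qed.

Lemma nkings_below_val n : (n < 9)%N -> nkings_below n = nth 0%N below_values n.
Proof.
move=> lt9; rewrite -nkings_below_values (nth_map 0%N) ?size_iota //.
by rewrite nth_iota.
Qed.

(* The last value is a sum because nat numerals above 5000 are parsed as an
   unevaluated conversion. *)
Definition king_values := [:: 1; 1; 0; 0; 2; 14; 90; 646; 568 + 4674]%N.

Lemma nkings_val n : (n < 9)%N -> nkings n = nth 0%N king_values n.
Proof.
case: n => [//|n] lt9; rewrite nkingsS !nkings_below_val //; last exact: ltnW.
by case: n lt9 => [|[|[|[|[|[|[|[|n]]]]]]]].
Qed.

Lemma total_occs_val n : (n < 9)%N ->
  total_occs n = nth 0%N [:: 0; 0; 0; 0; 0; 2; 14; 90; 646]%N n.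
Proof.
case: n => [_|n lt9]; first exact: total_occs0.
rewrite /total_occs total_noccs12.
transitivity (\sum_(k < n) nth 0 king_values k * nth 0 below_values (n - k))%N.
  apply: eq_bigr => k _; have ltk := ltn_ord k.
  by rewrite nkings_val ?nkings_below_val //; lia.
rewrite -(big_mkord xpredT
  (fun k => nth 0 king_values k * nth 0 below_values (n - k))%N).
(* Unlocking the big operator lets each concrete sum compute. *)
by case: n lt9 => [|[|[|[|[|[|[|[|n]]]]]]]] // _; rewrite unlock.
Qed.

Lemma avoiding_values :
  [seq #|kings_avoiding shading n| | n <- iota 0 9] =
  [:: 1; 1; 0; 0; 2; 12; 76; 556; 4596]%N.
Proof.
have avE n : #|kings_avoiding shading n| = (nkings n - total_occs n)%N.
  by rewrite -card_avoidingD addnK.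
by rewrite (eq_map avE) /= !nkings_val ?total_occs_val.
Qed.

Theorem theorem3p5 :
  [/\ let t := fpsX int in
      let A := king_gf int in
      let P := avoid_gf int shading in
      P =1 ((1 + t - (t * A) / (1 + t)) * A)%fps,
      let t := fpsX {poly int} in
      let u := fpsC ('X : {poly int}) in
      let A := king_gf {poly int} in
      let E := occ_gf shading in
      E =1 ((1 + t - u * t - (t * (1 - u) * A) / (1 + t)) * A)%fps
    & [seq occ_gf shading n | n <- iota 0 9] =
      [:: 1; 1; 0; 0; 2; 12 + 2 * 'X; 76 + 14 * 'X; 556 + 90 * 'X;
          4596 + 646 * 'X]].
Proof.
split.
- exact: avoidance_series_identity (king_gfE _) (total_gfE _) (avoid_gfE _).
- exact: occurrence_series_identity (king_gfE _) (total_gfE _) occ_gf_series.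
have [a0 a1 a2 a3 a4 a5 a6 a7 a8] := avoiding_values.
rewrite (eq_map occ_gfE) /= a0 a1 a2 a3 a4 a5 a6 a7 a8 !total_occs_val //=.
by rewrite !mul0r !addr0.
Qed.
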